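(* Let $M=U\subset\mathbb R^2$ be open, let $(U,F)$ be a conic pseudo-Finsler surface with $F$ defined on the conic sub-bundle $\mathcal A$, let $\phi:\mathcal A\to\mathbb R$ be a smooth function positively homogeneous of degree $0$ in $y$ with $\sigma+\varepsilon-(\phi_{;2})^2\neq0$ on $\mathcal A$, where $\sigma=\phi_{;2;2}+\varepsilon\mathcal I\phi_{;2}+2(\phi_{;2})^2$, and suppose that $\phi$ is a function of $y$ only (i.e. $\partial_i\phi=0$ for $i=1,2$). Let $\overline F=e^{\phi}F$ and assume that $F$ is projectively flat. Then $\overline F$ is projectively flat if and only if $\phi_{,2}=0$.
   Context: $(x^1,x^2)$ are the standard coordinates on $U\subset\mathbb R^2$ and $(x^i,y^i)$ the induced coordinates on $TU$; repeated indices are summed over $\{1,2\}$. Write $\partial_i=\partial/\partial x^i$, $\dot\partial_i=\partial/\partial y^i$. A function is $h(r)$ if it is positively homogeneous of degree $r$ in $y$. A conic sub-bundle is a non-empty open subset $\mathcal A\subset TU\setminus 0$ projecting onto $U$ and closed under multiplication by positive scalars. A conic pseudo-Finsler metric is a smooth $h(1)$ function $F:\mathcal A\to\mathbb R$ such that $g_{ij}=\tfrac12\dot\partial_i\dot\partial_jF^2$ is non-degenerate at each point of $\mathcal A$; $(g^{ij})$ is the inverse matrix. A conic pseudo-Finsler surface is equipped with its modified Berwald frame: $F$ is nowhere zero on $\mathcal A$, $\ell_i=\dot\partial_iF$, $\ell^i=y^i/F$, $\varepsilon\in\{1,-1\}$ (the signature) is the sign of $\det(g_{ij})$, $m_1=-\sqrt{\varepsilon\det(g_{ij})}\,\ell^2$,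 $m_2=\sqrt{\varepsilon\det(g_{ij})}\,\ell^1$, $m^i=g^{ij}m_j$; thus $g_{ij}=\ell_i\ell_j+\varepsilon m_im_j$, $\ell^im_i=0$, $m^im_i=\varepsilon$. The main scalar $\mathcal I$ is defined by $F\,C_{ijk}=\mathcal I\,m_im_jm_k$, where $C_{ijk}=\tfrac12\dot\partial_kg_{ij}$. The geodesic spray coefficients of $F$ are $G^i=\tfrac14g^{ij}(y^k\dot\partial_j\partial_kF^2-\partial_jF^2)$; $G^j_i=\dot\partial_iG^j$ and $\delta_i=\partial_i-G^j_i\dot\partial_j$. The condition $\sigma+\varepsilon-(\phi_{;2})^2\ne0$ guarantees that $\overline F$ is a conic pseudo-Finsler metric. A conic pseudo-Finsler metric $F$ on $U$ is projectively flat if $y^j\partial_j\dot\partial_iF=\partial_iF$ for all $i$ (equivalently $\dot\partial_i(y^j\partial_jF)=2\partial_iF$; equivalently $G^i=\mathcal Py^i$ with $\mathcal P=y^k\partial_kF/(2F)$). For a smooth function $f$ on $\mathcal A$: $f_{;2}:=\varepsilon F(\dot\partial_if)m^i$, $f_{;2;2}:=(f_{;2})_{;2}$, $f_{,2}:=\varepsilon(\delta_if)m^i$. *)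

(* Defs.v *)
From HB Require Import structures.
From mathcomp Require Import all_boot all_order all_algebra.
From mathcomp Require Import all_classical all_reals all_analysis.
Import Order.TTheory GRing.Theory Num.Theory.
Import numFieldNormedType.Exports.

Set Implicit Arguments.
Unset Strict Implicit.
Unset Printing Implicit Defensive.

Local Open Scope classical_set_scope.
Local Open Scope ring_scope.

(* A point of TU is a pair (x, y) in R^2 x R^2; the index i = 1, 2 of the      *)
(* mathematical notation is 0, 1 : 'I_2.  A function on the conic sub-bundle A *)
(* is a total function whose values outside A are irrelevant: everything below *)
(* is evaluated only at points of A, and, A being open, the derivatives there  *)
(* depend only on the restriction of the function to A.                        *)

Section Finsler.
Context {R : realType}.
Notation V := ('rV[R]_2 * 'rV[R]_2)%type.
Implicit Types (A : set V) (F f : V -> R) (p : V) (i j k : 'I_2).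

Definition dx i f : V -> R := 'D_((delta_mx 0 i, 0) : V) f.
Definition dy i f : V -> R := 'D_((0, delta_mx 0 i) : V) f.

(* C^oo: all iterated directional derivatives exist and are differentiable *)
Definition smooth_on A f : Prop :=
  forall (vs : seq V) p, A p -> differentiable (foldr (fun v h => 'D_v h) f vs) p.

Definition homogeneous_on A (r : int) f : Prop :=
  forall p (c : R), A p -> 0 < c -> f (p.1, c *: p.2) = c ^ r * f p.

Definition conic_subbundle (U : set 'rV[R]_2) A : Prop :=
  [/\ A !=set0, open A, fst @` A = U,
      forall p, A p -> p.2 != 0 &
      forall p (c : R), A p -> 0 < c -> A (p.1, c *: p.2)].

Definition fundamental F p : 'M[R]_2 :=
  \matrix_(i, j) (2^-1 * dy i (dy j (fun q => F q ^+ 2)) p).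

Definition fundamental_inv F p : 'M[R]_2 := invmx (fundamental F p).

Definition pseudo_finsler A F : Prop :=
  [/\ smooth_on A F, homogeneous_on A 1 F &
      forall p, A p -> fundamental F p \in unitmx].

(* The sign of det g, taken pointwise: it is locally constant on A, so this is *)
(* the constant signature whenever det g has a constant sign.                  *)
Definition signature F p : R := Num.sg (\det (fundamental F p)).

Definition ell_up F p i : R := p.2 0 i / F p.

Definition m_low F p i : R :=
  let s := Num.sqrt (signature F p * \det (fundamental F p)) in
  if i == 0 then - s * ell_up F p 1 else s * ell_up F p 0.

Definition m_up F p i : R := \sum_j fundamental_inv F p i j * m_low F p j.

Definition cartan F p i j k : R :=
  2^-1 * dy k (fun q => fundamental F q i j) p.

(* The scalar I with F C_ijk = I m_i m_j m_k; at a point of A it exists because *)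
(* C is symmetric with C_ijk y^k = 0, and is unique because (m_i) is non-zero.  *)
Definition main_scalar F p : R :=
  xget 0 [set c : R | forall i j k,
    F p * cartan F p i j k = c * m_low F p i * m_low F p j * m_low F p k].

Definition spray F i p : R :=
  4^-1 * \sum_j fundamental_inv F p i j *
    (\sum_k p.2 0 k * dy j (dx k (fun q => F q ^+ 2)) p
     - dx j (fun q => F q ^+ 2) p).

(* delta_i f = d_i f - G^j_i dot-d_j f, where G^j_i = dot-d_i G^j *)
Definition hderiv F i f p : R :=
  dx i f p - \sum_j dy i (spray F j) p * dy j f p.

(* f_{;2} *)
Definition vscalar F f p : R :=
  signature F p * F p * \sum_i dy i f p * m_up F p i.

(* f_{,2} *)
Definition hscalar F f p : R :=
  signature F p * \sum_i hderiv F i f p * m_up F p i.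

Definition sigma F f p : R :=
  vscalar F (vscalar F f) p
  + signature F p * main_scalar F p * vscalar F f p
  + 2 * vscalar F f p ^+ 2.

Definition projectively_flat A F : Prop :=
  forall p i, A p -> \sum_j p.2 0 j * dx j (dy i F) p = dx i F p.

End Finsler.

(* Main.v *)
(* Put S = y^k d_k F.  Since phi depends on y only, the defect
   y^j d_j dot-d_i Fbar - d_i Fbar equals e^phi (dot-d_i phi) S.  Projective
   flatness of F gives G^i = P y^i with P = S / (2 F), and Euler's relation
   y^i dot-d_i phi = 0 then reduces delta_i phi to - P dot-d_i phi, so that
   phi_{,2} = - eps P m^i dot-d_i phi.  As y^i and m^i span the plane, both
   conditions say that, at each point, S = 0 or all dot-d_i phi vanish. *)
Require Import Defs.
From HB Require Import structures.
From mathcomp Require Import all_boot all_order all_algebra.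
From mathcomp Require Import ring lra.
From mathcomp Require Import all_classical all_reals all_analysis.
Import Order.TTheory GRing.Theory Num.Theory.
Import numFieldNormedType.Exports.

Local Open Scope classical_set_scope.
Local Open Scope ring_scope.

(** * Directional derivatives: product and chain rules, mean values, symmetry of second
    derivatives *)

Section DirectionalDerivatives.
Context {R : realType} {V : normedModType R}.
Implicit Types (f g : V -> R) (p q u v w : V).

(** The two difference quotients are the same function of [h], so one-variable calculus applies
    along lines. *)
Lemma is_derive_line f q v (s : R) : derivable f (s *: v + q) v ->
  is_derive s 1 (fun s => f (s *: v + q)) ('D_v f (s *: v + q)).
Proof.
have E : (fun h : R => h^-1 *: (((fun t => f (t *: v + q)) \o shift s) (h *: 1)
      - f (s *: v + q))) =
    (fun h => h^-1 *: ((f \o shift (s *: v + q)) (h *: v) - f (s *: v + q))).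
  by apply/funext => h /=; rewrite [h *: 1]mulr1 scalerDl addrA.
by move=> df; apply: DeriveDef; rewrite /derivable /derive E.
Qed.

Lemma is_derive_translate f u q v : derivable f (u + q) v ->
  is_derive q v (fun q => f (u + q)) ('D_v f (u + q)).
Proof.
have E : (fun h : R => h^-1 *: (((fun q => f (u + q)) \o shift q) (h *: v)
      - f (u + q))) =
    (fun h => h^-1 *: ((f \o shift (u + q)) (h *: v) - f (u + q))).
  by apply/funext => h /=; rewrite addrCA.
by move=> df; apply: DeriveDef; rewrite /derivable /derive E.
Qed.

Lemma derivable_mul f g p v : derivable f p v -> derivable g p v ->
  derivable (fun q => f q * g q) p v.
Proof. exact: derivableM. Qed.

Lemma derive_mul f g p v : derivable f p v -> derivable g p v ->
  'D_v (fun q => f q * g q) p = f p * 'D_v g p + g p * 'D_v f p.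
Proof. exact: deriveM. Qed.

Lemma derive_sqr f p v : derivable f p v ->
  'D_v (fun q => f q ^+ 2) p = 2 * f p * 'D_v f p.
Proof.
move=> df; have -> : (fun q => f q ^+ 2) = (fun q => f q * f q).
  by apply/funext => q; rewrite expr2.
by rewrite derive_mul//; ring.
Qed.

Lemma derive_expR_comp f p v : differentiable f p ->
  'D_v (fun q => expR (f q)) p = expR (f p) * 'D_v f p.
Proof.
move=> df.
have de : differentiable (@expR R) (f p) by exact/derivable1_diffP.
rewrite !deriveE//; last exact: (differentiable_comp df de).
rewrite (diff_comp df de) /= deriv1E; last exact/derivable1_diffP.
by rewrite derive1E derive_val [LHS]mulrC.
Qed.

Lemma mvt_segment f q v (h : R) : 0 <= h ->
  (forall s, 0 <= s <= h -> derivable f (s *: v + q) v) ->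
  exists2 s, 0 <= s <= h & f (h *: v + q) - f q = 'D_v f (s *: v + q) * h.
Proof.
move=> h0 df.
have [||s sh] := @MVT_segment R (fun s => f (s *: v + q))
    (fun s => 'D_v f (s *: v + q)) 0 h h0.
- move=> s; rewrite in_itv /= => /andP[s0 sh].
  by apply/is_derive_line/df; rewrite !ltW.
- apply: derivable_within_continuous => s; rewrite in_itv /= => sh.
  by apply: ex_derive; apply/is_derive_line/df.
by move: sh; rewrite in_itv /= scale0r add0r subr0 => sh E; exists s.
Qed.

(** The mean value theorem is applied twice: along [v] to the increment
    [k q = f (h *: w + q) - f q], then along [w] to ['D_v f]. Each application contributes one
    factor [h]. *)
Lemma second_difference f p v w (h : R) : 0 <= h ->
  (forall s t, 0 <= s <= h -> 0 <= t <= h ->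
    differentiable f (s *: v + t *: w + p) /\
    differentiable ('D_v f) (s *: v + t *: w + p)) ->
  exists s t, [/\ 0 <= s <= h, 0 <= t <= h &
    f (h *: v + h *: w + p) - f (h *: v + p) - (f (h *: w + p) - f p) =
    'D_w ('D_v f) (s *: v + t *: w + p) * h * h].
Proof.
move=> h0 df; have hh : 0 <= h <= h by rewrite h0 lexx.
have zh : 0 <= (0 : R) <= h by rewrite h0 lexx.
pose k q := f (h *: w + q) - f q.
have dk s : 0 <= s <= h -> is_derive (s *: v + p) v k
    ('D_v f (s *: v + h *: w + p) - 'D_v f (s *: v + p)).
  move=> sh; have [d1 _] := df s h sh hh; have [d0 _] := df s 0 sh zh.
  move: d0; rewrite scale0r addr0 => d0.
  apply: (@is_deriveB _ _ _ (fun q => f (h *: w + q)) f).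
    rewrite addrAC addrC; apply: is_derive_translate.
    by rewrite addrC addrAC; exact: diff_derivable.
  exact/derivableP/diff_derivable.
have [s|s sh] := @mvt_segment k p v h h0; first by move=> /dk ds; exact: ex_derive.
rewrite (derive_val (is_derive := dk s sh)) /k => E1.
have [t th|t th] := @mvt_segment ('D_v f) (s *: v + p) w h h0.
  rewrite addrA [t *: w + _]addrC; apply: diff_derivable.
  by case: (df s t sh th).
rewrite !addrA ![_ *: w + s *: v]addrC => E2.
exists s, t; split=> //.
by rewrite -E2 -E1 addrA [h *: w + h *: v]addrC.
Qed.

Lemma distr_le_halves (a b c e : R) :
  `|a - c| < e / 2 -> `|b - c| < e / 2 -> `|a - b| <= e.
Proof.
move=> ac bc; rewrite (le_trans (ler_distD c _ _))// [e]splitr lerD ?ltW//.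
by rewrite distrC.
Qed.

(* Schwarz: the mixed second difference over a square of side h is
   h^2 D_w D_v f at one point of the square and h^2 D_v D_w f at another. *)
Lemma derive_comm f p v w :
  (\forall q \near p, differentiable f q) ->
  (\forall q \near p, differentiable ('D_v f) q) ->
  (\forall q \near p, differentiable ('D_w f) q) ->
  {for p, continuous ('D_w ('D_v f))} -> {for p, continuous ('D_v ('D_w f))} ->
  'D_w ('D_v f) p = 'D_v ('D_w f) p.
Proof.
move=> df dv dw /cvgrPdist_lt cvw /cvgrPdist_lt cwv.
apply/eqP; rewrite -subr_eq0 -normr_le0; apply/ler_addgt0Pl => e e0.
rewrite addr0.
have e2 : 0 < e / 2 by rewrite divr_gt0.
(* For small [h > 0] the whole parallelogram spanned at [p] by [h *: a] and [h *: b] lies in a given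
   neighbourhood of [p]. *)
have near_square (P : set V) (a b : V) : (\forall q \near p, P q) ->
    \forall h \near (0 : R)^'+, forall s t, 0 <= s <= h -> 0 <= t <= h ->
      P (s *: a + t *: b + p).
  move=> /nbhs_ballP[r /= r0 rP].
  (* The summand 1 keeps the divisor positive even when [a] and [b] both vanish. *)
  have c0 : 0 < `|a| + `|b| + 1 by rewrite ltr_wpDl// addr_ge0.
  near=> k => s t /andP[s0 sk] /andP[t0 tk]; apply: rP.
  rewrite -ball_normE /= opprD addrCA subrr addr0 normrN.
  apply: le_lt_trans (ler_normD _ _) _.
  rewrite !normrZ !ger0_norm//.
  have kr : k < r / (`|a| + `|b| + 1).
    by near: k; apply: nbhs_right_lt; rewrite divr_gt0.
  have k0 : 0 < k by near: k; exact: nbhs_right_gt.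
  move: kr; rewrite ltr_pdivlMr//; apply: le_lt_trans.
  rewrite 2!mulrDr mulr1 -[leLHS]addr0.
  by rewrite lerD ?lerD ?ler_wpM2r// ltW.
have [h [[[h0 near_vw] near_wv] [diff_v diff_w]]] :=
  filter_ex (filterI (filterI (filterI (nbhs_right_gt (0 : R))
      (near_square _ v w (cvw _ e2))) (near_square _ w v (cwv _ e2)))
    (filterI (near_square _ v w (filterI df dv))
      (near_square _ w v (filterI df dw)))).
have [s1 [t1 [s1h t1h E1]]] := @second_difference f p v w h (ltW h0) diff_v.
have [t2 [s2 [t2h s2h E2]]] := @second_difference f p w v h (ltW h0) diff_w.
(* Exchanging [v] and [w] does not change the second difference, so the two mean values agree once
   [h * h] is cancelled. *)
have {}E1 : 'D_w ('D_v f) (s1 *: v + t1 *: w + p) =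
    'D_v ('D_w f) (t2 *: w + s2 *: v + p).
  apply: (mulIf (lt0r_neq0 h0)); apply: (mulIf (lt0r_neq0 h0)).
  move: E2; rewrite (addrC (h *: w)) => E2; apply: etrans (esym E1) _.
  by apply: etrans E2; rewrite !opprB addrACA [- _ - _]addrC addrACA.
have A1 := near_vw _ _ s1h t1h; have A2 := near_wv _ _ t2h s2h.
rewrite E1 in A1; exact: (distr_le_halves _ _ _ _ A1 A2).
Unshelve. all: by end_near. Qed.

End DirectionalDerivatives.

(** * Smooth and homogeneous functions on an open set of tangent vectors *)

Section ConicCalculus.
Context {R : realType}.
Notation V := ('rV[R]_2 * 'rV[R]_2)%type.
Implicit Types (A : set V) (f : V -> R) (p v w : V) (i j k : 'I_2).

Lemma sum_ord2 (S : nmodType) (f : 'I_2 -> S) : \sum_i f i = f 0 + f 1.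
Proof.
rewrite !big_ord_recl big_ord0 addr0; congr (_ + f _).
exact: val_inj.
Qed.

Lemma ord2P i : i = 0 \/ i = 1.
Proof. by case: i => [[|[|m]] ilt] //; [left|right]; exact: val_inj. Qed.

Lemma smooth_diff A f p : smooth_on A f -> A p -> differentiable f p.
Proof. by move=> sf; exact: (sf [::]). Qed.

Lemma smooth_derive A f v : smooth_on A f -> smooth_on A ('D_v f).
Proof.
(* [foldr] applies the last direction of the list first, so [v] is appended at the end. *)
by move=> h vs p Ap; have := h (rcons vs v) p Ap; rewrite foldr_rcons.
Qed.

Lemma smooth_derivable A f p v : smooth_on A f -> A p -> derivable f p v.
Proof. by move=> sf Ap; apply: diff_derivable; exact: smooth_diff sf Ap. Qed.

Lemma smooth_derive_comm A f p v w : open A -> smooth_on A f -> A p ->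
  'D_w ('D_v f) p = 'D_v ('D_w f) p.
Proof.
move=> oA sf Ap; have nA : nbhs p A by exact: open_nbhs_nbhs.
apply: derive_comm.
- by apply: filterS nA => q; exact: smooth_diff.
- by apply: filterS nA => q; apply: smooth_diff; exact: smooth_derive.
- by apply: filterS nA => q; apply: smooth_diff; exact: smooth_derive.
- apply: differentiable_continuous; apply: smooth_diff Ap.
  by do 2!apply: smooth_derive.
- apply: differentiable_continuous; apply: smooth_diff Ap.
  by do 2!apply: smooth_derive.
Qed.

(** Derivatives are local and [A] is open; this allows identities known only on [A] to be
    differentiated. *)
Lemma derive_eq_on A f g p v : open A -> A p -> {in A, f =1 g} ->
  'D_v f p = 'D_v g p.
Proof.
move=> oA Ap fg; apply: near_eq_derive.
by apply: filterS (open_nbhs_nbhs (conj oA Ap)) => q Aq; rewrite fg// inE.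
Qed.

Lemma derive_fiber f p : differentiable f p ->
  'D_((0, p.2) : V) f p = \sum_i p.2 0 i * dy i f p.
Proof.
move=> df; rewrite sum_ord2 /dy !deriveE//.
have -> : (0, p.2) = p.2 0 0 *: ((0, delta_mx 0 0) : V) +
    p.2 0 1 *: ((0, delta_mx 0 1) : V).
  congr pair; first by rewrite /= !scaler0 addr0.
  apply/rowP => k; rewrite /= !mxE.
  by case: (ord2P k) => ->; rewrite /= ?mulr1 ?mulr0 ?addr0 ?add0r.
by rewrite linearD !linearZ.
Qed.

(** Euler's relation: differentiate [f (x, (s + 1) y) = (s + 1)^n f (x, y)] in [s] at 0. The left
    side gives the derivative along the fibre vector [(0, y)]. *)
Lemma euler A (n : nat) f p : open A -> homogeneous_on A n f -> A p ->
  differentiable f p -> \sum_i p.2 0 i * dy i f p = n%:R * f p.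
Proof.
move=> oA hf Ap df; rewrite -derive_fiber//.
have dv : derivable f p ((0, p.2) : V) by exact: diff_derivable.
have dl : is_derive (0 : R) 1 (fun s => f (s *: ((0, p.2) : V) + p))
    ('D_((0, p.2) : V) f p).
  have := @is_derive_line _ _ f p ((0, p.2) : V) 0.
  by rewrite scale0r add0r; exact.
have dr : is_derive (0 : R) 1 (f p *: (fun s : R => s + 1) ^+ n) (n%:R * f p).
  have d1 : is_derive (0 : R) 1 (fun s : R => s + 1) 1.
    exact: is_derive_shift.
  have := @is_deriveZ _ _ _ _ (f p) _ _ _ (@is_deriveX _ _ _ n _ _ _ d1).
  move=> d; apply: is_derive_eq d _; rewrite add0r expr1n.
  by rewrite mulr1 [_ *: 1]mulr1 [LHS]mulrC.
rewrite -(derive_val (is_derive := dl)) -(derive_val (is_derive := dr)).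
apply: near_eq_derive; near=> s.
(* Homogeneity holds for positive factors only, hence the restriction to [s] near 0. *)
have s1 : 0 < s + 1.
  have : `|0 - s| < 1 by near: s; exact: (nbhsx_ballx (0 : R) 1).
  by rewrite sub0r normrN ltr_norml => /andP[]; lra.
have -> : s *: ((0, p.2) : V) + p = (p.1, (s + 1) *: p.2).
  congr pair; first by rewrite /= scaler0 add0r.
  by rewrite /= scalerDl scale1r.
by rewrite hf// exprfctE mulrC.
Unshelve. all: by end_near. Qed.

Lemma is_derive_fiber_coord p v i : is_derive p v (fun q : V => q.2 0 i) (v.2 0 i).
Proof.
have E : (fun h : R => h^-1 *: (((fun q : V => q.2 0 i) \o shift p) (h *: v)
    - p.2 0 i)) @ 0^' --> v.2 0 i.
  (* By linearity of the coordinate, the quotient is constant for [h] different from 0. *)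
  apply: cvg_near_cst; near=> h => /=.
  rewrite !mxE addrK [_ *: _]mulrA mulVf ?mul1r//.
  by near: h; exact: nbhs_dnbhs_neq.
by apply: DeriveDef; [apply/cvg_ex; exists (v.2 0 i)|exact: cvg_lim E].
Unshelve. all: by end_near. Qed.

Lemma sum_delta (a : 'I_2 -> R) i :
  \sum_j a j * (delta_mx 0 i : 'rV[R]_2) 0 j = a i.
Proof.
rewrite (bigD1 i)//= mxE !eqxx mulr1 big1 ?addr0// => j ji.
by rewrite mxE (negbTE ji) andbF mulr0.
Qed.

Lemma derive_fiber_sum (a : 'I_2 -> V -> R) p v :
  (forall j, derivable (a j) p v) ->
  is_derive p v (fun q : V => \sum_j q.2 0 j * a j q)
    (\sum_j p.2 0 j * 'D_v (a j) p + \sum_j a j p * v.2 0 j).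
Proof.
move=> da; have c j := is_derive_fiber_coord p v j.
have d j : derivable (fun q : V => q.2 0 j) p v by case: (c j).
have -> : (fun q : V => \sum_j q.2 0 j * a j q) =
    \sum_j (fun q : V => q.2 0 j * a j q).
  by apply/funext => q; rewrite fct_sumE.
apply: DeriveDef; first by apply: derivable_sum => j; exact: derivable_mul.
rewrite derive_sum => [|j]; last exact: derivable_mul.
rewrite -big_split/=; apply: eq_bigr => j _.
by rewrite derive_mul// (derive_val (is_derive := c j)).
Qed.

End ConicCalculus.

(** * Linear algebra of covectors and vectors in the plane *)

Section Pairings.
Context {R : realType}.
Implicit Types (u y z a : 'I_2 -> R).

(* In the plane u.z = 0 with u.y and z non-zero makes y and z independent. *)
Lemma eq0_of_pairings u y z a :
  \sum_i u i * y i != 0 -> \sum_i u i * z i = 0 -> (exists i, z i != 0) ->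
  \sum_i a i * y i = 0 -> \sum_i a i * z i = 0 -> forall i, a i = 0.
Proof.
rewrite !sum_ord2 => uy uz zn0 ay az.
set d := y 0 * z 1 - y 1 * z 0.
(* Cramer's rule: each [a i * d] is a combination of the two vanishing pairings of [a]. *)
have ad : a 0 * d = 0 /\ a 1 * d = 0.
  split.
    transitivity ((a 0 * y 0 + a 1 * y 1) * z 1
      - (a 0 * z 0 + a 1 * z 1) * y 1); first by rewrite /d; ring.
    by rewrite ay az !mul0r subr0.
  transitivity ((a 0 * z 0 + a 1 * z 1) * y 0
    - (a 0 * y 0 + a 1 * y 1) * z 0); first by rewrite /d; ring.
  by rewrite ay az !mul0r subr0.
suff d0 : d != 0.
  by move=> i; apply: (mulIf d0); rewrite mul0r; case: (ord2P i) => ->; case: ad.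
(* If the determinant [d] vanished, [u.z = 0] would give [(u.y) z = 0], although [u.y] and [z] are
   both non-zero. *)
apply/eqP => d0; have zd : (u 0 * y 0 + u 1 * y 1) * z 0 = 0 /\
    (u 0 * y 0 + u 1 * y 1) * z 1 = 0.
  split.
    transitivity (y 0 * (u 0 * z 0 + u 1 * z 1) - u 1 * d);
      first by rewrite /d; ring.
    by rewrite uz d0 !mulr0 subr0.
  transitivity (y 1 * (u 0 * z 0 + u 1 * z 1) + u 0 * d);
    first by rewrite /d; ring.
  by rewrite uz d0 !mulr0 addr0.
case: zn0 => i /eqP; apply; apply: (mulfI uy); rewrite mulr0.
by case: (ord2P i) => ->; case: zd.
Qed.

Lemma pairing_transpose (g : 'M[R]_2) y z :
  \sum_j (\sum_i y i * g i j) * z j = \sum_i y i * \sum_j g i j * z j.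
Proof.
under eq_bigr do rewrite mulr_suml.
rewrite exchange_big; apply: eq_bigr => i _; rewrite mulr_sumr.
by apply: eq_bigr => j _; rewrite mulrA.
Qed.

(** This is [y^i m_i = 0], with [c] standing for [F] and [s] for the square root in [m_low]: the
    covector is [y] turned by a right angle and rescaled. *)
Lemma rotated_pairing (y0 y1 s c : R) :
  y0 * (- s * (y1 / c)) + y1 * (s * (y0 / c)) = 0.
Proof. by ring. Qed.

End Pairings.

(** * Euler's relation for the metric and its fundamental tensor *)

Section ProjectivelyFlat.
Context {R : realType}.
Notation V := ('rV[R]_2 * 'rV[R]_2)%type.
Context {A : set V} {F : V -> R}.
Context (oA : open A) (finsler : pseudo_finsler A F).
Context (F_neq0 : forall p, A p -> F p != 0).
Implicit Types (f : V -> R) (p v : V) (i j k : 'I_2).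

Let smF : smooth_on A F. Proof. by case: finsler. Qed.
Let homF : homogeneous_on A 1 F. Proof. by case: finsler. Qed.
Let g_unit p : A p -> fundamental F p \in unitmx.
Proof. by case: finsler => _ _; exact. Qed.

(* For a projectively flat F the projective factor is
   P = spray_pairing F / (2 F), and the spray is G^i = P y^i. *)
Definition spray_pairing f p : R := \sum_k p.2 0 k * dx k f p.

(** Differentiate Euler's relation for [F] along [y^i]: the derivative of the coordinate factor
    yields [dy i F], which cancels the right side. *)
Lemma euler_dy p i : A p -> \sum_j p.2 0 j * dy i (dy j F) p = 0.
Proof.
move=> Ap.
have E : {in A, (fun q : V => \sum_j q.2 0 j * dy j F q) =1 F}.
  move=> q; rewrite inE => Aq.
  by rewrite (euler _ 1 _ _ oA homF Aq (smooth_diff _ _ _ smF Aq)) mul1r.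
have d j : derivable (dy j F) p (0, delta_mx 0 i).
  by apply: smooth_derivable Ap; exact: smooth_derive.
have := derive_eq_on _ _ _ _ (0, delta_mx 0 i) oA Ap E.
rewrite (derive_val (is_derive := derive_fiber_sum _ _ _ d)) sum_delta => E1.
by apply: (addIr (dy i F p)); rewrite add0r.
Qed.

Lemma dx_sqr p i : A p -> dx i (fun q => F q ^+ 2) p = 2 * (F p * dx i F p).
Proof. by move=> Ap; rewrite mulrA; exact/derive_sqr/(smooth_derivable A). Qed.

Lemma derive_half_sqr v w p : A p ->
  'D_v ('D_w (fun q => F q ^+ 2)) p
    = 2 * (F p * 'D_v ('D_w F) p + 'D_w F p * 'D_v F p).
Proof.
move=> Ap; have dF : derivable F p v by exact: smooth_derivable Ap.
have dwF : derivable ('D_w F) p v.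
  by apply: smooth_derivable Ap; exact: smooth_derive.
rewrite (derive_eq_on _ _ (fun q => 2 * (F q * 'D_w F q)) _ _ oA Ap).
  rewrite -derive_mul//; apply: (@deriveZ _ _ _ (fun q => F q * 'D_w F q)).
  exact: derivable_mul.
move=> q; rewrite inE => Aq; rewrite mulrA.
by apply: derive_sqr; exact: smooth_derivable Aq.
Qed.

Lemma fundamentalE p i j : A p ->
  fundamental F p i j = F p * dy i (dy j F) p + dy j F p * dy i F p.
Proof. by move=> Ap; rewrite mxE [dy i _ _]derive_half_sqr// mulKf. Qed.

(** In [g_ij = F F_ij + F_i F_j] the Hessian term is killed by [y] through [euler_dy], while Euler's
    relation turns the other term into [F F_i]. *)
Lemma fundamental_fiber p : A p ->
  fundamental F p *m p.2^T = \col_i (F p * dy i F p).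
Proof.
move=> Ap; apply/colP => i; rewrite !mxE.
have E j : fundamental F p i j * p.2^T j 0 =
    F p * (p.2 0 j * dy i (dy j F) p) + dy i F p * (p.2 0 j * dy j F p).
  have term (u a b c y : R) : (u * a + b * c) * y = u * (y * a) + c * (y * b).
    by ring.
  by rewrite fundamentalE// [p.2^T _ _]mxE; exact: term.
rewrite (eq_bigr _ (fun j _ => E j)) big_split -!mulr_sumr/= euler_dy//.
rewrite (euler _ 1 _ _ oA homF Ap (smooth_diff _ _ _ smF Ap)).
by rewrite mulr0 mul1r add0r mulrC.
Qed.

Lemma fundamental_inv_dy p i : A p ->
  \sum_j fundamental_inv F p i j * dy j F p = p.2 0 i / F p.
Proof.
move=> Ap; apply: (mulIf (F_neq0 p Ap)); rewrite divfK ?F_neq0//.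
have := congr1 (mulmx (fundamental_inv F p)) (fundamental_fiber p Ap).
rewrite mulKmx ?g_unit// => /colP/(_ i); rewrite !mxE => ->.
rewrite mulr_suml; apply: eq_bigr => j _.
by rewrite !mxE [F p * _]mulrC mulrA.
Qed.

(** * The spray of a projectively flat metric *)

Context (F_flat : projectively_flat A F).

(** Flatness replaces [dx j F] by [y^k] times mixed second derivatives; these cancel in the bracket,
    leaving [2 S dy j F] with [S = spray_pairing F p]. Then [g^ij] sends [dy j F] to [y^i / F]. *)
Lemma spray_flat p i : A p ->
  spray F i p = spray_pairing F p / (2 * F p) * p.2 0 i.
Proof.
move=> Ap; rewrite /spray.
have E j : \sum_k p.2 0 k * dy j (dx k (fun q => F q ^+ 2)) p
    - dx j (fun q => F q ^+ 2) p = 2 * spray_pairing F p * dy j F p.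
  rewrite dx_sqr// -(F_flat p j Ap) /spray_pairing.
  rewrite !(mulr_sumr, mulr_suml) -sumrB; apply: eq_bigr => k _.
  have comm : dy j (dx k F) p = dx k (dy j F) p.
    exact: smooth_derive_comm oA smF Ap.
  have dd : dy j (dx k (fun q => F q ^+ 2)) p =
      2 * (F p * dy j (dx k F) p + dx k F p * dy j F p).
    exact: derive_half_sqr.
  have term (y u a b c : R) :
      y * (2 * (u * a + b * c)) - 2 * (u * (y * a)) = 2 * (y * b) * c.
    by ring.
  by rewrite dd comm; exact: term.
under eq_bigr => j _ do rewrite E mulrCA.
rewrite -mulr_sumr fundamental_inv_dy//; field.
by rewrite F_neq0.
Qed.

Lemma derivable_spray_pairing p v : A p -> derivable (spray_pairing F) p v.
Proof.
move=> Ap.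
have d j : derivable (dx j F) p v.
  by apply: smooth_derivable Ap; exact: smooth_derive.
by case: (derive_fiber_sum _ _ _ d).
Qed.

Lemma dy_spray_flat p i j : A p ->
  dy i (spray F j) p = dy i (fun q => spray_pairing F q / (2 * F q)) p * p.2 0 j
    + spray_pairing F p / (2 * F p) * (delta_mx 0 i : 'rV[R]_2) 0 j.
Proof.
move=> Ap; set P := fun q => _.
rewrite /dy (derive_eq_on _ _ (fun q => P q * q.2 0 j) _ _ oA Ap); last first.
  by move=> q; rewrite inE; exact: spray_flat.
have c := is_derive_fiber_coord p (0, delta_mx 0 i) j.
rewrite derive_mul ?(derive_val (is_derive := c)).
- by rewrite addrC [p.2 0 j * _]mulrC.
- apply: derivable_mul; first exact: derivable_spray_pairing.
  apply: derivableV; first by rewrite mulf_neq0 ?F_neq0 ?pnatr_eq0.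
  by apply: (@derivableZ _ _ _ F); exact: smooth_derivable Ap.
- by case: c.
Qed.

(** * Degree-zero functions: horizontal derivatives and the exponential change of the metric *)

Section DegreeZeroFunction.
Context {f : V -> R}.
Context (smf : smooth_on A f) (homf : homogeneous_on A 0 f).

(** Differentiating [G^j = P y^j] gives two terms. The one with [dy i P] carries [y^j dy j f], which
    is zero in degree 0; the Kronecker delta in the other selects [dy i f]. *)
Lemma hderiv_flat p i : A p -> dx i f p = 0 ->
  hderiv F i f p = - (spray_pairing F p / (2 * F p) * dy i f p).
Proof.
move=> Ap f0; rewrite /hderiv f0 sub0r; congr (- _).
set P := fun q => spray_pairing F q / (2 * F q); rewrite -/(P p).
have E j : dy i (spray F j) p * dy j f p =
    dy i P p * (p.2 0 j * dy j f p)
    + P p * (dy j f p * (delta_mx 0 i : 'rV[R]_2) 0 j).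
  by rewrite dy_spray_flat// -/P -/(P p); ring.
rewrite (eq_bigr _ (fun j _ => E j)) big_split -!mulr_sumr/= sum_delta.
rewrite (euler _ 0 _ _ oA homf Ap (smooth_diff _ _ _ smf Ap)).
by rewrite mul0r mulr0 add0r.
Qed.

(** The covector [dy i f] annihilates [y] by Euler's relation in degree 0 and [m^i] by hypothesis,
    and these two vectors are independent. *)
Lemma dy_eq0_of_frame p : A p -> p.2 != 0 ->
  \sum_i dy i f p * m_up F p i = 0 -> forall i, dy i f p = 0.
Proof.
move=> Ap p0 fm; pose g := fundamental F p.
have F0 := F_neq0 p Ap.
have gy i : \sum_j g i j * p.2 0 j = F p * dy i F p.
  have /colP/(_ i) := fundamental_fiber p Ap; rewrite !mxE => <-.
  by apply: eq_bigr => j _; rewrite [p.2^T _ _]mxE.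
have gm i : \sum_j g i j * m_up F p j = m_low F p i.
  have /colP/(_ i) := mulKVmx (g_unit p Ap) (\col_j m_low F p j).
  rewrite mxE [RHS]mxE => <-; apply: eq_bigr => j _; congr (_ * _).
  rewrite [RHS]mxE; apply: eq_bigr => k _; congr (_ * _).
  by rewrite [RHS]mxE.
have ym : \sum_i p.2 0 i * m_low F p i = 0.
  by rewrite sum_ord2 /m_low /ell_up /=; exact: rotated_pairing.
(* y_j := y^i g_ij satisfies y_j y^j = F^2 and y_j m^j = y^i m_i = 0. *)
apply: (eq0_of_pairings (fun j => \sum_i p.2 0 i * g i j)
    (p.2 0) (m_up F p)) => //.
- rewrite (pairing_transpose g) (eq_bigr _ (fun i _ => congr1 _ (gy i))).
  under eq_bigr => i _ do rewrite mulrCA.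
  rewrite -mulr_sumr (euler _ 1 _ _ oA homF Ap (smooth_diff _ _ _ smF Ap)).
  by rewrite mul1r mulf_neq0.
- by rewrite (pairing_transpose g) (eq_bigr _ (fun i _ => congr1 _ (gm i))).
(* [m^i] is non-zero: otherwise lowering the index gives [m_i = 0], and since the square root in
   [m_low] is non-zero, [y] would vanish. *)
- apply/existsP; apply: contraNT p0; rewrite negb_exists => /forallP m0.
  have ml i : m_low F p i = 0.
    rewrite -gm big1// => j _; have := m0 j; rewrite negbK => /eqP ->.
    exact: mulr0.
  have s0 : Num.sqrt (signature F p * \det g) != 0.
    (* The sign times the determinant is the absolute value of the determinant, positive because [g]
       is invertible. *)
    rewrite gt_eqF// sqrtr_gt0 /signature -normrEsg normr_gt0 -unitfE.
    by rewrite -unitmxE g_unit.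
  have := ml 0; have := ml 1; rewrite /m_low /ell_up /= mulNr.
  move=> /eqP; rewrite mulf_eq0 (negbTE s0) mulf_eq0 invr_eq0 (negbTE F0) orbF.
  move=> /eqP y0 /eqP; rewrite oppr_eq0.
  rewrite mulf_eq0 (negbTE s0) mulf_eq0 invr_eq0 (negbTE F0) orbF => /eqP y1.
  by apply/eqP/rowP => i; rewrite mxE; case: (ord2P i) => ->.
- rewrite -[RHS](mul0r (f p)).
  rewrite -(euler _ 0 _ _ oA homf Ap (smooth_diff _ _ _ smf Ap)).
  by apply: eq_bigr => i _; rewrite mulrC.
Qed.

Lemma hscalar_flat p : A p -> (forall i, dx i f p = 0) ->
  hscalar F f p = - (signature F p * (spray_pairing F p / (2 * F p))
    * \sum_i dy i f p * m_up F p i).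
Proof.
move=> Ap f0; rewrite /hscalar -mulrA -mulrN; congr (_ * _).
rewrite mulr_sumr -sumrN; apply: eq_bigr => i _.
by rewrite hderiv_flat// mulNr mulrA.
Qed.

Lemma derive_expR_mul h p v : A p -> derivable h p v ->
  'D_v (fun q => expR (f q) * h q) p
    = expR (f p) * (h p * 'D_v f p + 'D_v h p).
Proof.
move=> Ap dh; have df := smooth_diff _ _ _ smf Ap.
have de : derivable (fun q => expR (f q)) p v.
  apply: diff_derivable; apply: (differentiable_comp df).
  by apply/derivable1_diffP; exact: derivable_expR.
rewrite (derive_mul _ _ _ _ de dh) (derive_expR_comp _ _ _ df).
by rewrite mulrDr addrC mulrCA.
Qed.

(** No [x]-derivative falls on [f], so only those of [F] and [dy i F] survive; flatness of [F]
    cancels the latter against [dx i F]. *)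
Lemma flatness_defect p i : A p -> (forall q j, A q -> dx j f q = 0) ->
  \sum_j p.2 0 j * dx j (dy i (fun q => expR (f q) * F q)) p
    - dx i (fun q => expR (f q) * F q) p
  = expR (f p) * (dy i f p * spray_pairing F p).
Proof.
move=> Ap f0.
have dF q v : A q -> derivable F q v by move=> Aq; exact: smooth_derivable Aq.
have E j : dx j (dy i (fun q => expR (f q) * F q)) p
    = expR (f p) * (dy i f p * dx j F p + dx j (dy i F) p).
  rewrite /dx (derive_eq_on _ _ (fun q => expR (f q) *
    (F q * dy i f q + dy i F q)) _ _ oA Ap); last first.
    by move=> q; rewrite inE => Aq; apply: derive_expR_mul => //; exact: dF.
  have dyf : derivable (dy i f) p (delta_mx 0 j, 0).
    by apply: smooth_derivable Ap; exact: smooth_derive.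
  have dyF : derivable (dy i F) p (delta_mx 0 j, 0).
    by apply: smooth_derivable Ap; exact: smooth_derive.
  have dFf := derivable_mul _ _ _ _ (dF p (delta_mx 0 j, 0) Ap) dyf.
  rewrite (derive_expR_mul _ _ _ Ap (derivableD dFf dyF)).
  rewrite -/(dx j f p) (f0 p j Ap) mulr0 add0r; congr (_ * _).
  rewrite (deriveD dFf dyF) (derive_mul _ _ _ _ (dF _ _ Ap) dyf).
  (* After the swap, [dx j f] vanishes on all of the open set [A], hence so does its fibre
     derivative. *)
  rewrite (smooth_derive_comm _ _ _ _ _ oA smf Ap).
  rewrite (derive_eq_on _ _ (cst 0) _ _ oA Ap); last first.
    by move=> q; rewrite inE => Aq; exact: f0.
  by rewrite derive_cst mulr0 add0r.
have Ei : dx i (fun q => expR (f q) * F q) p = expR (f p) * dx i F p.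
  rewrite [LHS](derive_expR_mul _ _ _ Ap (dF _ _ Ap)).
  by rewrite -/(dx i f p) (f0 p i Ap) mulr0 add0r.
rewrite Ei -(F_flat p i Ap) /spray_pairing !mulr_sumr -sumrB.
apply: eq_bigr => j _; rewrite E.
have term (e y a b c : R) :
    y * (e * (a * b + c)) - e * (y * c) = e * (a * (y * b)).
  by ring.
exact: term.
Qed.

End DegreeZeroFunction.
End ProjectivelyFlat.

(** * Projective flatness of the changed metric, treated point by point *)

Theorem proposition5p1 (R : realType) (U : set 'rV[R]_2)
    (A : set ('rV[R]_2 * 'rV[R]_2)%type)
    (F phi : ('rV[R]_2 * 'rV[R]_2)%type -> R)
    (hU : open U)
    (hA : conic_subbundle U A)
    (hF : pseudo_finsler A F)
    (hF0 : forall p, A p -> F p != 0)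
    (hphi : smooth_on A phi)
    (hphi0 : homogeneous_on A 0 phi)
    (hsigma : forall p, A p ->
      sigma F phi p + signature F p - vscalar F phi p ^+ 2 != 0)
    (hphiy : forall p (i : 'I_2), A p -> dx i phi p = 0)
    (hflat : projectively_flat A F) :
  projectively_flat A (fun p => expR (phi p) * F p) <->
  (forall p, A p -> hscalar F phi p = 0).
Proof.
have [_ oA _ y_neq0 _] := hA.
have hscalarE p : A p -> hscalar F phi p =
    - (signature F p * (spray_pairing F p / (2 * F p))
      * \sum_i dy i phi p * m_up F p i).
  by move=> Ap; apply: (hscalar_flat oA hF hF0) => // i; exact: hphiy.
have defect p i (Ap : A p) := flatness_defect oA hF hflat hphi p i Ap hphiy.
split=> [flat p Ap|hs p i Ap].
  have dS i : dy i phi p * spray_pairing F p = 0.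
    have /eqP := defect p i Ap; rewrite flat// subrr eq_sym mulf_eq0.
    by rewrite expR_eq0 => /eqP.
  rewrite hscalarE//; apply/eqP; rewrite oppr_eq0 -mulrA; apply/eqP.
  have [S0|S0] := eqVneq (spray_pairing F p) 0; first by rewrite S0 !mul0r mulr0.
  rewrite big1 ?mulr0// => i _.
  move/eqP: (dS i); rewrite mulf_eq0 (negbTE S0) orbF => /eqP ->.
  exact: mul0r.
apply/eqP; rewrite -subr_eq0 defect//.
(* A product vanishes. Its factors [signature F p] and the inverse of [2 * F p] do not, so either
   the spray pairing or the pairing of [dy i phi] with [m^i] is zero. *)
have /eqP := hs p Ap; rewrite hscalarE// oppr_eq0 !mulf_eq0 invr_eq0 mulf_eq0.
rewrite pnatr_eq0 (negbTE (hF0 p Ap)) /= orbF.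
have -> : (signature F p == 0) = false.
  rewrite sgr_eq0; apply/negbTE; rewrite -unitfE -unitmxE.
  by case: hF => _ _; apply.
case/orP => [/=/eqP S0|/eqP m0]; first by rewrite S0 eqxx !orbT.
have dphi0 := dy_eq0_of_frame oA hF hF0 hphi hphi0 p Ap (y_neq0 p Ap) m0.
by rewrite dphi0 eqxx orbT.
Qed.
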